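(* Let $Q_s$ and $\tilde{Q}_s$, $s\ge 0$, be the queue-length processes described in the context, driven respectively by the true conditional decoding-failure probabilities and by upper bounds on them. Suppose that $Q_0=\tilde{Q}_0$. Then the process $Q_s$ is stochastically dominated by $\tilde{Q}_s$, i.e. $Q_s\preceq\tilde{Q}_s$ for every $s\ge 0$.
   Context: Stochastic order: $Z\preceq\tilde{Z}$ means $\Pr(Z>z)\le\Pr(\tilde{Z}>z)$ for all $z\in\mathbb{R}$. Queueing model: packets arrive according to a Poisson process with rate $\lambda$ packets per channel use; codewords have length $N$; $A_s$ is the number of arrivals during the $s$-th codeword interval, so the $A_s$ are i.i.d. Poisson with mean $\lambda N$. The underlying finite-state channel evolves as a Markov chain independent of the arrivals, queue sizes and code generation; $C_{sN+1}$ is the channel state at the start of the $s$-th codeword, and $\vec{C}=\{C_1,C_{N+1},C_{2N+1},\dots\}$ is the channel trace. Each codeword carries the last segment of a packet with probability $\rho_r\in(0,1)$, independently of everything else (packet lengths are geometric, and the number of codewords per packet is geometric with parameter $\rho_r$). For a trace $\vec{c}$ and interval $s$, let $P_{\mathrm{e}|\vec{C}=\vec{c}}$ be the conditional probability that the $s$-th codeword fails to be decoded, and let $\tilde{P}_{\mathrm{e}|\vec{C}=\vec{c}}\in[0,1]$ be an upper bound, $P_{\mathrm{e}|\vec{C}=\vec{c}}\le\tilde{P}_{\mathrm{e}|\vec{C}=\vec{c}}$ (for each $s$ and $\vec{c}$; the dependence on $s$ is suppressed). The potential packet completion indicators $D_s,\tilde{D}_s\in\{0,1\}$ satisfy $$\Pr(D_s=1|\vec{C}=\vec{c})=(1-P_{\mathrm{e}|\vec{C}=\vec{c}})\rho_r,\qquad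 \Pr(\tilde{D}_s=1|\vec{C}=\vec{c})=(1-\tilde{P}_{\mathrm{e}|\vec{C}=\vec{c}})\rho_r .$$ Conditionally on $\vec{C}$, the variable $D_s$ (resp. $\tilde{D}_s$) is independent of $A_s$ and of the past of the queue, and $A_s$ is independent of the past of the queue; in particular, conditionally on $\vec{C}$, the variables $Q_s,A_s,D_s$ are mutually independent, and likewise $\tilde{Q}_s,A_s,\tilde{D}_s$. The queue lengths are nonnegative integer valued and evolve by $$Q_{s+1}=(Q_s+A_s-D_s)^+,\qquad \tilde{Q}_{s+1}=(\tilde{Q}_s+A_s-\tilde{D}_s)^+,\qquad (x)^+=\max\{0,x\}.$$ *)

(* Defs.v *)
From mathcomp Require Export all_boot all_order all_algebra.
From mathcomp Require Export all_classical all_reals all_analysis.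

Set Implicit Arguments.
Unset Strict Implicit.
Unset Printing Implicit Defensive.
Export Order.TTheory GRing.Theory Num.Theory.

Local Open Scope classical_set_scope.
Local Open Scope ring_scope.
Local Open Scope ereal_scope.

Definition stoch_le {d} {T : measurableType d} {R : realType}
    (P : probability T R) (Z Z' : T -> R) : Prop :=
  forall z : R, P [set w | (z < Z w)%R] <= P [set w | (z < Z' w)%R].

(* Trace space S^nat with its product sigma-algebra; S carries the discrete
   sigma-algebra, so the cylinders over single states generate it when S is
   countable. *)
Definition cylinders (S : pointedType) : set (set (nat -> S)) :=
  [set B | exists (n : nat) (x : S), B = [set c | c n = x]].

Definition traceType (S : pointedType) := g_sigma_algebraType (@cylinders S).

Section conditioning.
Context {d : measure_display} {T : measurableType d} {R : realType}.
Context (P : probability T R) {S : pointedType} (Z : T -> traceType S).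

(* f is a version of c |-> Pr(E | Z = c). *)
Definition is_cond_prob (E : set T) (f : traceType S -> R) : Prop :=
  [/\ measurable_fun [set: traceType S] f,
      forall c, (0 <= f c <= 1)%R &
      forall B : set (traceType S), measurable B ->
        P (E `&` Z @^-1` B) = \int[P]_(w in Z @^-1` B) (f (Z w))%:E].

(* Conditional independence given Z of random elements with values in discrete
   countable spaces, where every subset is measurable. Versions of conditional
   probabilities being unique almost surely, it does not matter which ones the
   existential quantifiers pick. *)
Definition cond_indep (U V : countType) (X : T -> U) (Y : T -> V) : Prop :=
  forall (A : set U) (B : set V), exists f g : traceType S -> R,
    [/\ is_cond_prob (X @^-1` A) f, is_cond_prob (Y @^-1` B) g &
        is_cond_prob (X @^-1` A `&` Y @^-1` B) (fun c => f c * g c)%R].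

End conditioning.

Section channel.
Context {d : measure_display} {T : measurableType d} {R : realType}.
Context (P : probability T R) {S : pointedType}.

(* Channel states are indexed from 1; C 0 is never used. *)
Definition channel_path (C : nat -> T -> S) (n : nat) (c : nat -> S) : set T :=
  [set w | forall i, (1 <= i <= n)%N -> C i w = c i].

Definition channel_trace (N : nat) (C : nat -> T -> S) (w : T) : traceType S :=
  fun s => C (s * N).+1 w.

(* Pr(C_(n+1) = y | C_1, ..., C_n) = Pr(C_(n+1) = y | C_n), with denominators
   cleared; transition probabilities may depend on n. *)
Definition markov_chain (C : nat -> T -> S) : Prop :=
  forall (n : nat) (c : nat -> S), (1 <= n)%N ->
    P (channel_path C n.+1 c) * P [set w | C n w = c n] =
    P (channel_path C n c) * P [set w | C n w = c n /\ C n.+1 w = c n.+1].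

Definition arrival_path (A : nat -> T -> nat) (m : nat) (a : nat -> nat)
    : set T :=
  [set w | forall i, (i < m)%N -> A i w = a i].

(* Independence of the channel from the exogenous data of the queue, namely its
   initial length and the arrivals, on the generating cylinder events. *)
Definition channel_indep (C : nat -> T -> S) (A : nat -> T -> nat)
    (Q0 : T -> nat) : Prop :=
  forall n c m a q,
    P (channel_path C n c `&` (arrival_path A m a `&` [set w | Q0 w = q])) =
    P (channel_path C n c) * P (arrival_path A m a `&` [set w | Q0 w = q]).

Definition iid_poisson (A : nat -> T -> nat) (mu : R) : Prop :=
  (forall (n : nat) (B : nat -> set nat),
     P (\bigcap_(i in `I_n) (A i @^-1` B i)) =
     \prod_(i < n) P (A i @^-1` B i)) /\
  (forall s k, P [set w | A s w = k] = (poisson_pmf mu k)%:E).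

End channel.

Definition pos_part (x : int) : int := Num.max 0%R x.

Section queue.
Context {d : measure_display} {T : measurableType d} {R : realType}.
Context (P : probability T R) {S : pointedType} (Z : T -> traceType S).

Definition queue_past (Q : nat -> T -> nat) (s : nat) (w : T) : seq nat :=
  [seq Q i w | i <- iota 0 s.+1].

(* Queue Q with arrivals A and potential packet completion indicators D, when
   Pe s c is the conditional failure probability (or the bound used in its
   place) of codeword s given the trace c. The conditional independence fields
   together make Q s, A s and D s mutually independent given the trace. *)
Record is_queue (rho : R) (Pe : nat -> traceType S -> R) (A : nat -> T -> nat)
    (D : nat -> T -> bool) (Q : nat -> T -> nat) : Prop := IsQueue {
  queue_step : forall s w,
    Posz (Q s.+1 w) = pos_part (Posz (Q s w) + Posz (A s w) - Posz (D s w))%R ;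
  completion_prob : forall s,
    is_cond_prob P Z [set w | D s w = true] (fun c => (1 - Pe s c) * rho)%R ;
  completion_indep : forall s,
    cond_indep P Z (D s) (fun w => (A s w, queue_past Q s w)) ;
  arrival_indep : forall s, cond_indep P Z (A s) (queue_past Q s) }.

End queue.

(* Main.v *)
(** Stochastic dominance of [Q s] by [Qt s] is not inductive, because the service
    probabilities depend on the trace; dominance conditionally on the trace is.
    Splitting over the number [a] of arrivals, conditional independence gives
    Pr(Q_(s+1) >= k, A_s = a | c) = p ((1 - e) u + e v), where
    p = Pr(A_s = a | c), u = Pr(Q_s >= k - a | c), v = Pr(Q_s >= k + 1 - a | c)
    and e = (1 - Pe s c) rho. Since v <= u, this decreases in e, hence increases
    with Pe, and it increases with u and v. *)
Require Import Defs.
From mathcomp Require Import all_boot all_order all_algebra.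
From mathcomp Require Import all_classical all_reals all_analysis.
From mathcomp Require Import measurable_realfun zify lra.

Local Open Scope classical_set_scope.
Local Open Scope ring_scope.

(** * Conditional probabilities given the trace, compared almost surely *)

Section cond_prob.
Set Implicit Arguments.
Unset Strict Implicit.
Context {d : measure_display} {T : measurableType d} {R : realType}.
Context (P : probability T R) {S : pointedType}.
Context (Z : {mfun T >-> traceType S}).

Let mu := distribution P Z.

(* By [cond_prob_le_ae] and [le_ae_cond_prob], Pr(E | Z) <= Pr(E' | Z) almost
   surely, stated without choosing versions. *)
Definition cond_dom (E E' : set T) : Prop :=
  forall B : set (traceType S), measurable B ->
    (P (E `&` Z @^-1` B) <= P (E' `&` Z @^-1` B))%E.

(** A change of variables along [Z] replaces integrals over [T] by integrals against the law [mu] of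
    the trace, so that versions can be compared [mu]-almost everywhere. *)
Lemma is_cond_probP (E : set T) (f : traceType S -> R) :
  is_cond_prob P Z E f <->
  [/\ measurable_fun setT f, forall c, 0 <= f c <= 1 &
      forall B, measurable B ->
        P (E `&` Z @^-1` B) = (\int[mu]_(c in B) (f c)%:E)%E].
Proof.
have push (B : set (traceType S)) : measurable_fun setT f ->
    (forall c, 0 <= f c <= 1) -> measurable B ->
    (\int[mu]_(c in B) (f c)%:E = \int[P]_(w in Z @^-1` B) (f (Z w))%:E)%E.
  move=> mf f01 mB; rewrite ge0_integral_pushforward//.
    by apply/measurable_EFinP; exact: measurable_funTS.
  by move=> c _; rewrite lee_fin; case/andP: (f01 c).
split=> -[mf f01 fE]; split=> // B mB.
  by rewrite push// fE.
by rewrite -push// fE.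
Qed.

Lemma cond_prob_integrable (E B : set _) (f : traceType S -> R) :
  measurable B -> is_cond_prob P Z E f -> mu.-integrable B (EFin \o f).
Proof.
move=> mB [mf f01 _]; apply: measurable_bounded_integrable => //.
- by rewrite (le_lt_trans (probability_le1 _ _))// ltry.
- exact: measurable_funTS.
- exists 1; split; first exact: num_real.
  move=> M M1 c _ /=; have /andP[f0 f1] := f01 c.
  by rewrite ger0_norm// (le_trans f1)// ltW.
Qed.

(** On measurable subsets of [D], domination bounds the integral of [f] by that of [f'], while
    [f' < f] gives the reverse bound. Hence [f = f'] almost everywhere on [D], which forces [D] to
    be null. *)
Lemma cond_prob_le_ae (E E' : set T) (f f' : traceType S -> R) :
  is_cond_prob P Z E f -> is_cond_prob P Z E' f' -> cond_dom E E' ->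
  {ae mu, forall c, f c <= f' c}.
Proof.
move=> cf cf' EE'; pose D := [set c | f' c < f c].
have [mf f01 fE] := (is_cond_probP E f).1 cf.
have [mf' f'01 f'E] := (is_cond_probP E' f').1 cf'.
have mD : measurable D.
  rewrite -[D]setTI.
  by apply: (measurable_fun_ltr mf' mf measurableT (Y := [set true])).
have : ae_eq mu D (EFin \o f) (EFin \o f').
  apply: integral_ae_eq => //.
  - exact: cond_prob_integrable cf.
  - by apply/measurable_EFinP; exact: measurable_funTS.
  - move=> B BD mB; apply/eqP; rewrite eq_le; apply/andP; split.
      by rewrite /= -fE// -f'E// EE'.
    apply: ge0_le_integral => //.
    + by move=> c _; rewrite lee_fin; case/andP: (f'01 c).
    + by apply/measurable_EFinP; exact: measurable_funTS.
    + by apply/measurable_EFinP; exact: measurable_funTS.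
    + by move=> c /BD /ltW; rewrite lee_fin.
apply: filterS => c eqD; rewrite leNgt; apply/negP => Dc.
by have [ffc] := eqD Dc; move: Dc; rewrite ffc ltxx.
Qed.

Lemma cond_prob_ae_eq (E : set T) (f f' : traceType S -> R) :
  is_cond_prob P Z E f -> is_cond_prob P Z E f' -> {ae mu, forall c, f c = f' c}.
Proof.
move=> cf cf'.
have ff' : {ae mu, forall c, f c <= f' c} by exact: cond_prob_le_ae cf cf' _.
have f'f : {ae mu, forall c, f' c <= f c} by exact: cond_prob_le_ae cf' cf _.
by apply: filterS2 ff' f'f => c ? ?; apply/le_anti/andP.
Qed.

Lemma le_ae_cond_prob (E E' : set T) (f f' : traceType S -> R) :
  is_cond_prob P Z E f -> is_cond_prob P Z E' f' ->
  {ae mu, forall c, f c <= f' c} -> cond_dom E E'.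
Proof.
move=> /is_cond_probP[mf f01 fE] /is_cond_probP[mf' f'01 f'E] ff' B mB.
rewrite fE// f'E//; apply: ae_ge0_le_integral => //.
- by move=> c _; rewrite lee_fin; case/andP: (f01 c).
- by apply/measurable_EFinP; exact: measurable_funTS.
- by move=> c _; rewrite lee_fin; case/andP: (f'01 c).
- by apply/measurable_EFinP; exact: measurable_funTS.
- by apply: filterS ff' => c; rewrite lee_fin.
Qed.

Lemma eq_ae_cond_prob (E : set T) (f f' : traceType S -> R) :
  measurable_fun setT f' -> (forall c, 0 <= f' c <= 1) ->
  {ae mu, forall c, f c = f' c} -> is_cond_prob P Z E f -> is_cond_prob P Z E f'.
Proof.
move=> mf' f'01 ff' /is_cond_probP[mf f01 fE]; apply/is_cond_probP; split=> //.
move=> B mB; rewrite fE//; apply: ae_eq_integral => //.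
- by apply/measurable_EFinP; exact: measurable_funTS.
- by apply/measurable_EFinP; exact: measurable_funTS.
- by apply: filterS ff' => c -> _.
Qed.

(** The versions picked by [cond_indep] agree almost surely with any given [f] and [g], so the
    product formula carries over to these. *)
Lemma cond_indep_cond_prob (U V : countType) (X : T -> U) (Y : T -> V)
    (A : set U) (B : set V) (f g : traceType S -> R) :
  cond_indep P Z X Y ->
  is_cond_prob P Z (X @^-1` A) f -> is_cond_prob P Z (Y @^-1` B) g ->
  is_cond_prob P Z (X @^-1` A `&` Y @^-1` B) (fun c => f c * g c).
Proof.
move=> /(_ A B) [f1 [g1 [cf1 cg1 c1]]] cf cg.
have [mf f01 _] := cf; have [mg g01 _] := cg.
apply: eq_ae_cond_prob c1.
- exact: measurable_funM.
- move=> c; have /andP[? ?] := f01 c; have /andP[? ?] := g01 c.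
  by rewrite mulr_ge0//= mulr_ile1.
- have ff : {ae mu, forall c, f1 c = f c} by exact: cond_prob_ae_eq cf1 cf.
  have gg : {ae mu, forall c, g1 c = g c} by exact: cond_prob_ae_eq cg1 cg.
  by apply: filterS2 ff gg => c -> ->.
Qed.

Lemma is_cond_probU (E E' : set T) (f f' : traceType S -> R) :
  measurable E -> measurable E' -> [disjoint E & E'] ->
  (forall c, f c + f' c <= 1) ->
  is_cond_prob P Z E f -> is_cond_prob P Z E' f' ->
  is_cond_prob P Z (E `|` E') (fun c => f c + f' c).
Proof.
move=> mE mE' /disj_setPS dE ff1 cf cf'.
have [mf f01 fE] := (is_cond_probP E f).1 cf.
have [mf' f'01 f'E] := (is_cond_probP E' f').1 cf'.
apply/is_cond_probP; split=> [|c|B mB].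
- exact: measurable_funD.
- have /andP[? ?] := f01 c; have /andP[? ?] := f'01 c.
  by rewrite ff1 andbT addr_ge0.
- have mZB : measurable (Z @^-1` B) by exact: measurable_funPTI.
  have -> : (P ((E `|` E') `&` Z @^-1` B) =
      P (E `&` Z @^-1` B) + P (E' `&` Z @^-1` B))%E.
    rewrite setIUl measureU//; [exact: measurableI|exact: measurableI|].
    by apply/seteqP; split=> // w [[Ew _] [E'w _]]; exact: dE.
  rewrite fE// f'E// -integralD//.
    exact: cond_prob_integrable cf.
  exact: cond_prob_integrable cf'.
Qed.

Lemma is_cond_probC (E : set T) (f : traceType S -> R) :
  measurable E -> is_cond_prob P Z E f ->
  is_cond_prob P Z (~` E) (fun c => 1 - f c).
Proof.
move=> mE cf; have [mf f01 fE] := (is_cond_probP E f).1 cf.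
have mf' : measurable_fun setT (fun c => 1 - f c) by exact: measurable_funB.
have f'01 c : 0 <= 1 - f c <= 1.
  by have /andP[? ?] := f01 c; apply/andP; split; lra.
apply/is_cond_probP; split=> // B mB.
have mZB : measurable (Z @^-1` B) by exact: measurable_funPTI.
have PE : (P (Z @^-1` B) = P (E `&` Z @^-1` B) + P (~` E `&` Z @^-1` B))%E.
  rewrite -measureU; last first.
  - by apply/seteqP; split=> // w [[Ew _] [E'w _]]; exact: E'w.
  - by apply: measurableI => //; exact: measurableC.
  - exact: measurableI.
  by rewrite -setIUl setUv setTI.
have : (P (Z @^-1` B) = \int[mu]_(c in B) (f c)%:E
    + \int[mu]_(c in B) (1 - f c)%:E)%E.
  rewrite -ge0_integralD//.
  - rewrite (_ : P _ = mu B)// -[mu B]mul1e -integral_cst//.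
    by apply: eq_integral => c _; rewrite -EFinD; congr EFin; lra.
  - by move=> c _; rewrite lee_fin; case/andP: (f01 c).
  - by apply/measurable_EFinP; exact: measurable_funTS.
  - by move=> c _; rewrite lee_fin; case/andP: (f'01 c).
  - by apply/measurable_EFinP; exact: measurable_funTS.
(* Finiteness allows cancelling this term in the extended reals. *)
have Pfin : P (E `&` Z @^-1` B) \is a fin_num.
  by apply: fin_num_measure; exact: measurableI.
rewrite PE -fE// ![(P (E `&` _) + _)%E]addeC => PE'.
by rewrite -[LHS](addeK _ Pfin) PE' addeK.
Qed.

Lemma cond_dom_bigcup (E E' : (set T)^nat) :
  (forall n, measurable (E n)) -> (forall n, measurable (E' n)) ->
  trivIset setT E -> trivIset setT E' -> (forall n, cond_dom (E n) (E' n)) ->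
  cond_dom (\bigcup_n E n) (\bigcup_n E' n).
Proof.
move=> mE mE' tE tE' EE' B mB.
have mZB : measurable (Z @^-1` B) by exact: measurable_funPTI.
rewrite !setI_bigcupl !measure_bigcup.
- by apply: lee_nneseries => // n _; exact: EE'.
- by move=> n _; exact: measurableI.
- exact: trivIset_setIr.
- by move=> n _; exact: measurableI.
- exact: trivIset_setIr.
Qed.

End cond_prob.

Lemma measurable_channel_trace (d : measure_display) (T : measurableType d)
    (S : pointedType) (N : nat) (C : nat -> T -> S) :
  (forall n x, (1 <= n)%N -> measurable [set w | C n w = x]) ->
  measurable_fun [set: T] (channel_trace N C).
Proof.
move=> mC.
apply: (@measurability _ _ T (traceType S) _ _ (@cylinders S) erefl).
by move=> _ [_ [n [x ->]] <-]; rewrite setTI; exact: mC.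
Qed.

(** A positive threshold does not see the truncation of the queue at 0. The subtractions on the
    right are truncated too: once the arrivals alone reach the threshold, the condition on [q] is
    vacuous. *)
Lemma pos_part_geq (k q a : nat) (b : bool) (n : nat) : (0 < k)%N ->
  Posz n = pos_part (Posz q + Posz a - Posz b) ->
  (k <= n)%N = ((if b then k.+1 - a else k - a) <= q)%N.
Proof. by rewrite /pos_part; case: b => k0 nE; apply/idP/idP; lia. Qed.

(** * The queue recursion conditionally on the trace *)

Section queue.
Set Implicit Arguments.
Unset Strict Implicit.
Context {d : measure_display} {T : measurableType d} {R : realType}.
Context (P : probability T R) {S : pointedType}.
Context (Z : {mfun T >-> traceType S}).
Context (rho : R) (rho01 : 0 < rho < 1).
Context (A : nat -> {mfun T >-> nat}).

Let backlog (Q : nat -> T -> nat) (s k : nat) : set T := [set w | (k <= Q s w)%N].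

Let arrivals (s a : nat) : set T := A s @^-1` [set a].

Lemma last_queue_past (Q : nat -> T -> nat) s w : last 0%N (queue_past Q s w) = Q s w.
Proof. by rewrite /queue_past -[s.+1]addn1 iotaD map_cat last_cat. Qed.

(** Independence is assumed for the whole past of the queue; this exhibits the backlog as an event
    of that past. The past has [s.+1] entries, so the default of [last] is never returned. *)
Lemma backlog_past (Q : nat -> T -> nat) s k :
  backlog Q s k = queue_past Q s @^-1` [set p | (k <= last 0 p)%N].
Proof.
by apply/funext => w; rewrite /backlog /preimage /mkset last_queue_past.
Qed.

Lemma measurable_backlog (Q : nat -> {mfun T >-> nat}) s k :
  measurable (backlog Q s k).
Proof. exact: (measurable_funPTI (Q s) (Y := [set n | (k <= n)%N])). Qed.

Lemma measurable_arrivals s a : measurable (arrivals s a).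
Proof. exact: measurable_funPTI. Qed.

Section one_queue.
Context {Pe : nat -> traceType S -> R} {D : nat -> {mfun T >-> bool}}.
Context {Q : nat -> {mfun T >-> nat}} (queueQ : is_queue P Z rho Pe A D Q).

Let delta s c := (1 - Pe s c) * rho.

(** Versions come from the independence fields of [is_queue], applied with the full set as the other
    event. *)
Lemma arrivals_cond_prob s a : exists f, is_cond_prob P Z (arrivals s a) f.
Proof. by have [f [_ [cf _ _]]] := arrival_indep queueQ s [set a] setT; exists f. Qed.

Lemma backlog_cond_prob s k : exists f, is_cond_prob P Z (backlog Q s k) f.
Proof.
rewrite backlog_past.
have [_ [g [_ cg _]]] :=
  arrival_indep queueQ s setT [set p | (k <= last 0 p)%N].
by exists g.
Qed.

Lemma backlog_step_cond_prob s k a (p u v : traceType S -> R) : (0 < k)%N ->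
  is_cond_prob P Z (arrivals s a) p ->
  is_cond_prob P Z (backlog Q s (k - a)) u ->
  is_cond_prob P Z (backlog Q s (k.+1 - a)) v ->
  is_cond_prob P Z (arrivals s a `&` backlog Q s.+1 k)
    (fun c => (1 - delta s c) * (p c * u c) + delta s c * (p c * v c)).
Proof.
move=> k0 cp cu cv.
have cD := completion_prob queueQ s; rewrite -/(delta s) in cD.
have mD : measurable (D s @^-1` [set true]) by exact: measurable_funPTI.
have cDC := is_cond_probC mD cD.
(* Independence is used twice: arrivals against the past, then completion against the pair of
   arrivals and past. *)
have joint i (f g : traceType S -> R) b :
    is_cond_prob P Z (D s @^-1` [set b]) f ->
    is_cond_prob P Z (backlog Q s i) g ->
    is_cond_prob P Z (D s @^-1` [set b] `&` (arrivals s a `&` backlog Q s i))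
      (fun c => f c * (p c * g c)).
  move=> cf cg; rewrite backlog_past in cg *.
  have cpg := cond_indep_cond_prob (arrival_indep queueQ s) cp cg.
  exact: (cond_indep_cond_prob (completion_indep queueQ s)
    (B := [set x | x.1 = a /\ (i <= last 0 x.2)%N]) cf cpg).
(* Split on completion: a departure raises the required backlog by one. *)
have -> : arrivals s a `&` backlog Q s.+1 k =
    (D s @^-1` [set false] `&` (arrivals s a `&` backlog Q s (k - a))) `|`
    (D s @^-1` [set true] `&` (arrivals s a `&` backlog Q s (k.+1 - a))).
  apply/seteqP; rewrite /arrivals /backlog; split=> w /=.
    move=> [Aw]; rewrite (pos_part_geq k0 (queue_step queueQ s w)) Aw.
    by case: (D s w); [right|left].
  by case=> -[Dw [Aw]]; rewrite (pos_part_geq k0 (queue_step queueQ s w)) Dw Aw.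
have mj i b : measurable (D s @^-1` [set b] `&` (arrivals s a `&` backlog Q s i)).
  apply: measurableI; first exact: measurable_funPTI.
  by apply: measurableI; [exact: measurable_arrivals|exact: measurable_backlog].
apply: is_cond_probU => //.
- by apply/disj_setPS => w [[/= -> _] []].
- move=> c; have [_ /(_ c) p01 _] := cp; have [_ /(_ c) u01 _] := cu.
  have [_ /(_ c) v01 _] := cv; have [_ /(_ c) d01 _] := cD.
  have /andP[? ?] := p01; have /andP[? ?] := u01; have /andP[? ?] := v01.
  have /andP[? ?] := d01.
  have : p c * u c <= 1 by rewrite mulr_ile1.
  have : p c * v c <= 1 by rewrite mulr_ile1.
  by nra.
- apply: joint => //.
  rewrite (_ : _ @^-1` _ = ~` (D s @^-1` [set true]))//.
  by apply/seteqP; split=> w /=; case: (D s w).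
- exact: joint.
Qed.

End one_queue.

(** * Comparison of the two queues *)

Lemma arrivals_bigcup (E : set T) s : \bigcup_a (arrivals s a `&` E) = E.
Proof.
rewrite -setI_bigcupl (_ : \bigcup_a _ = setT) ?setTI//.
by apply/seteqP; split=> // w _; exists (A s w).
Qed.

Lemma trivIset_arrivals (E : set T) s :
  trivIset setT (fun a => arrivals s a `&` E).
Proof. by move=> a b _ _ [w [[/= <- _] [/= <- _]]]. Qed.

Lemma queue_cond_dom (Pe Pet : nat -> traceType S -> R)
    (D Dt : nat -> {mfun T >-> bool}) (Q Qt : nat -> {mfun T >-> nat}) :
  (forall s c, Pe s c <= Pet s c) ->
  is_queue P Z rho Pe A D Q -> is_queue P Z rho Pet A Dt Qt ->
  Q 0%N =1 Qt 0%N ->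
  forall s k, cond_dom P Z (backlog Q s k) (backlog Qt s k).
Proof.
(* The induction keeps [k] general, since the step calls on thresholds [k - a] and [k.+1 - a]. *)
move=> Pe_le qQ qQt Q0E; have /andP[rho0 rho1] := rho01; elim=> [|s IHs] k.
  have -> : backlog Q 0 k = backlog Qt 0 k.
    by apply/seteqP; split=> w; rewrite /backlog /= Q0E.
  by move=> B mB.
have [->|k0] := posnP k.
  by rewrite (_ : backlog Qt _ _ = backlog Q s.+1 0).
rewrite -(arrivals_bigcup (backlog Q _ _) s) -(arrivals_bigcup (backlog Qt _ _) s).
have marr (X : nat -> {mfun T >-> nat}) a :
    measurable (arrivals s a `&` backlog X s.+1 k).
  by apply: measurableI; [exact: measurable_arrivals|exact: measurable_backlog].
apply: cond_dom_bigcup => //; [exact: trivIset_arrivals..|move=> a].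
(* The queues share their arrivals, so a single version [p] serves both. *)
have [p cp] := arrivals_cond_prob qQ s a.
have [u cu] := backlog_cond_prob qQ s (k - a).
have [v cv] := backlog_cond_prob qQ s (k.+1 - a).
have [ut cut] := backlog_cond_prob qQt s (k - a).
have [vt cvt] := backlog_cond_prob qQt s (k.+1 - a).
have vu : {ae distribution P Z, forall c, v c <= u c}.
  apply: cond_prob_le_ae cv cu _ => B mB.
  have mZB : measurable (Z @^-1` B) by exact: measurable_funPTI.
  apply: le_measure; rewrite ?inE; [| |].
  - by apply: measurableI => //; exact: measurable_backlog.
  - by apply: measurableI => //; exact: measurable_backlog.
  - by apply: setSI => w; rewrite /backlog /=; lia.
have uut : {ae distribution P Z, forall c, u c <= ut c}.
  exact: cond_prob_le_ae cu cut (IHs _).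
have vvt : {ae distribution P Z, forall c, v c <= vt c}.
  exact: cond_prob_le_ae cv cvt (IHs _).
apply: le_ae_cond_prob (backlog_step_cond_prob qQ k0 cp cu cv)
  (backlog_step_cond_prob qQt k0 cp cut cvt) _.
apply: filterS3 vu uut vvt => c vu uut vvt /=.
have [_ /(_ c) /andP[p0 _] _] := cp.
have [_ /(_ c) /andP[d0 d1] _] := completion_prob qQ s.
have [_ /(_ c) /andP[dt0 dt1] _] := completion_prob qQt s.
have dtd : (1 - Pet s c) * rho <= (1 - Pe s c) * rho.
  by rewrite ler_pM2r// lerD2l lerN2.
set e := (1 - Pe s c) * rho in d0 d1 dtd *.
set et := (1 - Pet s c) * rho in dt0 dt1 dtd *.
(* With the factor [p c] removed, lowering [e] to [et] shifts weight from [v] to the larger [u];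
   then [u] and [v] are raised to [ut] and [vt]. *)
rewrite ![_ * (p c * _)]mulrCA -!mulrDr ler_wpM2l//.
have le1 : (1 - et) * u c <= (1 - et) * ut c by rewrite ler_wpM2l// subr_ge0.
have le2 : et * v c <= et * vt c by rewrite ler_wpM2l.
have le3 : et * (u c - v c) <= e * (u c - v c) by rewrite ler_wpM2r// subr_ge0.
by lra.
Qed.

End queue.

(** * From conditional to unconditional dominance *)

Theorem proposition6
  (R : realType) (d : measure_display) (T : measurableType d)
  (P : probability T R)
  (lambda rho : R) (N : nat)
  (St : pointedType) (C : nat -> T -> St)
  (A : nat -> {RV P >-> nat})
  (F : nat -> {RV P >-> bool})
  (Pe Pet : nat -> traceType St -> R)
  (D Dt : nat -> {RV P >-> bool})
  (Q Qt : nat -> {RV P >-> nat})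
  (lambda_gt0 : 0 < lambda)
  (N_gt0 : (0 < N)%N)
  (rho01 : 0 < rho < 1)
  (finS : finite_set [set: St])
  (mC : forall n x, (1 <= n)%N -> measurable [set w | C n w = x])
  (markovC : markov_chain P C)
  (indepC : channel_indep P C A (Q 0%N))
  (poissonA : iid_poisson P A (lambda * N%:R))
  (* F s is the event that codeword s fails to be decoded *)
  (PeE : forall s,
     is_cond_prob P (channel_trace N C) [set w | F s w = true] (Pe s))
  (Pet01 : forall s c, 0 <= Pet s c <= 1)
  (Pe_le : forall s c, Pe s c <= Pet s c)
  (queueQ : is_queue P (channel_trace N C) rho Pe A D Q)
  (queueQt : is_queue P (channel_trace N C) rho Pet A Dt Qt)
  (Q0E : Q 0%N =1 Qt 0%N) :
  forall s : nat,
    stoch_le P (fun w => (Q s w)%:R) (fun w => (Qt s w)%:R).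
Proof.
move=> s z.
pose Z : {mfun T >-> traceType St} :=
  mfun_Sub (mem_set (measurable_channel_trace N mC)).
(* Below 0 both events are the whole space. *)
have [z0|z0] := ltrP z 0.
  have all_w (X : nat -> {RV P >-> nat}) : [set w | z < (X s w)%:R] = setT.
    by apply/seteqP; split=> // w _ /=; rewrite (lt_le_trans z0).
  by rewrite !all_w.
(* For [z] nonnegative, an integer exceeds [z] exactly when it exceeds [Num.truncn z], so the event
   is a backlog with threshold one more. Taking all traces as the conditioning event removes the
   conditioning. *)
have trunc_w (X : nat -> {RV P >-> nat}) :
    [set w | z < (X s w)%:R] = [set w | (Num.truncn z < X s w)%N] `&` Z @^-1` setT.
  by rewrite preimage_setT setIT; apply/seteqP; split=> w /=; rewrite truncn_lt_nat.
rewrite !trunc_w.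
exact: (queue_cond_dom (Z := Z) rho01 Pe_le queueQ queueQt Q0E).
Qed.
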